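(* Let $(V, e)$ be an order unit space and assume that $u \in V^+ \setminus \{0, e\}$. Then $u$ has the order unit property in $V$ if and only if $\|u\| = 1 = \|e - u\|$ and $(e - u) \perp_{\infty} [-u, u]$ (that is, $(e - u) \perp_{\infty} v$ whenever $v \in V$ with $v \in [-u, u]$).
   Context: An order unit space $(V,e)$ is a real ordered vector space $V$ with proper positive cone $V^+$ (where $x \le y$ means $y - x \in V^+$), with an order unit $e \in V^+$, $e \neq 0$ (for every $v \in V$ there is $k>0$ with $ke \pm v \in V^+$), such that $V^+$ is Archimedean; it carries the order unit norm $\|v\| = \inf\{k > 0 : ke \pm v \in V^+\}$. For $u \in V^+$, $[-u,u] = \{v \in V : -u \le v \le u\}$. Order unit property (OUP): $u \in V^+$ has the order unit property in $V$ if, for all $v \in V$, one has $\|v\| u \pm v \in V^+$ whenever $\lambda u \pm v \in V^+$ for some real $\lambda > 0$. For elements $x, y$ of a non-zero real normed linear space, $x \perp_{\infty} y$ means $\|x + k y\| = \max\{\|x\|, \|k y\|\}$ for all $k \in \mathbb{R}$.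
   Formalization: The left side of the equivalence is read as ''u ≤ e and u has the order unit property''; without u ≤ e the claim fails, since u = 2e has the order unit property but norm 2. *)

(* Defs.v *)
From mathcomp Require Import all_boot all_order all_algebra.
From mathcomp Require Import all_classical all_reals.

Set Implicit Arguments.
Unset Strict Implicit.
Unset Printing Implicit Defensive.

Import Order.TTheory GRing.Theory Num.Theory.
Local Open Scope classical_set_scope.
Local Open Scope ring_scope.

(* P is the positive cone of V; e is the order unit.  The Archimedean property
   is the one of ordered vector spaces, over every positive w; given the order
   unit it is the same to ask it for w = e only. *)
Record order_unit_space (R : realType) (V : lmodType R) (P : set V) (e : V)
    : Prop := OrderUnitSpace {
  cone_add : forall v w : V, P v -> P w -> P (v + w);
  cone_scale : forall (t : R) (v : V), 0 <= t -> P v -> P (t *: v);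
  cone_proper : forall v : V, P v -> P (- v) -> v = 0;
  unit_pos : P e;
  unit_neq0 : e <> 0;
  unit_order : forall v : V,
    exists k : R, [/\ 0 < k, P (k *: e + v) & P (k *: e - v)];
  cone_archimedean : forall v w : V, P w ->
    (forall k : R, 0 < k -> P (k *: w + v)) -> P v
}.

Definition cone_le (R : realType) (V : lmodType R) (P : set V) (x y : V) : Prop :=
  P (y - x).

Definition order_interval (R : realType) (V : lmodType R) (P : set V) (u : V)
    : set V :=
  [set v | cone_le P (- u) v /\ cone_le P v u].

Definition unit_norm (R : realType) (V : lmodType R) (P : set V) (e v : V) : R :=
  inf [set k : R | [/\ 0 < k, P (k *: e + v) & P (k *: e - v)]].

Definition order_unit_property (R : realType) (V : lmodType R) (P : set V)
    (e u : V) : Prop :=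
  forall v : V,
    (exists lambda : R,
       [/\ 0 < lambda, P (lambda *: u + v) & P (lambda *: u - v)]) ->
    P (unit_norm P e v *: u + v) /\ P (unit_norm P e v *: u - v).

Definition infty_orthogonal (R : realType) (V : lmodType R) (nrm : V -> R)
    (x y : V) : Prop :=
  forall k : R, nrm (x + k *: y) = Num.max (nrm x) (nrm (k *: y)).

(* Main.v *)
Require Import Defs.
From mathcomp Require Import all_boot all_order all_algebra.
From mathcomp Require Import all_classical all_reals.
From mathcomp Require Import ring lra.

Import Order.TTheory GRing.Theory Num.Theory.
Local Open Scope classical_set_scope.
Local Open Scope ring_scope.

(** The Archimedean property makes the infimum defining the norm attained, so
    that [unit_norm P e v <= c] just says [- c e <= v <= c e]
    ([unit_norm_leP]); the theorem is then a matter of combining inequalities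
    in the cone.

    From the order unit property to orthogonality: applied to [u] itself the
    property forces [norm u = 1]; and if [norm (e - u) < 1], then [u] dominates
    a positive multiple of [e], so the property applies to [e] and gives
    [e <= u].  If [w] is a multiple of an element of [[-u, u]], the property
    gives [- n u <= w <= n u] with [n = norm w].  As [u] and [e - u] are
    positive with sum [e], [e - u + w] then lies between [- m e] and [m e] for
    [m = max(1, n)].  For the reverse inequality put [s = norm (e - u + w)].
    The heuristic is that of states: a state with value 1 at [e - u] vanishes
    at [u], hence at [w], so that [1 <= s]; and a state with value [- n] at [w]
    has value 1 at [u], so vanishes at [e - u], and [n <= s].  Instead of
    states, [norm_compl_ge1] and [norm_le_compl_add] use the convex combinations
    that turn these two remarks into inequalities in the cone.

    From orthogonality to the order unit property: if [v] is dominated by a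
    multiple of [u] and [n = norm v > 0], then [v / n] is a multiple of an
    element of [[-u, u]], so orthogonality gives [norm (e - u + v / n) <= 1],
    in particular [e - u + v / n <= e], which is [v <= n u]. *)

Set Implicit Arguments.
Unset Strict Implicit.

(** * Linear identities in three vectors *)

Section Lin3.
Variables (R : realType) (V : lmodType R).

Definition lin3 (x y z : V) (a b c : R) : V := a *: x + b *: y + c *: z.

Variables x y z : V.

Lemma lin3D a b c a' b' c' :
  lin3 x y z a b c + lin3 x y z a' b' c' =
  lin3 x y z (a + a') (b + b') (c + c').
Proof. by rewrite /lin3 !scalerDl addrACA; congr (_ + _); rewrite addrACA. Qed.

Lemma lin3N a b c : - lin3 x y z a b c = lin3 x y z (- a) (- b) (- c).
Proof. by rewrite /lin3 !scaleNr !opprD. Qed.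

Lemma lin3Z k a b c :
  k *: lin3 x y z a b c = lin3 x y z (k * a) (k * b) (k * c).
Proof. by rewrite /lin3 !scalerDr !scalerA. Qed.

(** The normal form of a linear combination of [x], [y], [z].  It is provided
    through an abstract [L], because rewriting [x] into [lin3 x y z 1 0 0] would
    leave occurrences of [x] to be rewritten again. *)
Lemma lin3_normal_form : exists L : R -> R -> R -> V,
  [/\ x = L 1 0 0, y = L 0 1 0 & z = L 0 0 1] /\
  [/\ forall a b c a' b' c',
        L a b c + L a' b' c' = L (a + a') (b + b') (c + c'),
      forall a b c, - L a b c = L (- a) (- b) (- c) &
      forall k a b c, k *: L a b c = L (k * a) (k * b) (k * c)].
Proof.
exists (lin3 x y z).
do 2 split; rewrite ?/lin3 ?scale0r ?scale1r ?addr0 ?add0r //.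
- exact: lin3D.
- exact: lin3N.
- exact: lin3Z.
Qed.

End Lin3.

Ltac lin3_congr x y z :=
  let L := fresh "L" in
  let hx := fresh in let hy := fresh in let hz := fresh in
  let hD := fresh in let hN := fresh in let hZ := fresh in
  have [L [[hx hy hz] [hD hN hZ]]] := @lin3_normal_form _ _ x y z;
  rewrite ?hx ?hy ?hz ?(hZ, hN, hD);
  congr (L _ _ _).

Section OrderUnitSpace.
Variables (R : realType) (V : lmodType R) (P : set V) (e : V).
Hypothesis HV : order_unit_space P e.

Local Notation norm := (unit_norm P e).

(** * The cone and the order unit norm *)

Lemma cone_scale_inv (t : R) (x : V) : 0 < t -> P (t *: x) -> P x.
Proof.
move=> t0 Px; rewrite -(scale1r x) -(mulVf (lt0r_neq0 t0)) -scalerA.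
by apply: (cone_scale HV) => //; rewrite invr_ge0 ltW.
Qed.

Lemma cone_scale_mono (a b : R) (x y : V) :
  P x -> a <= b -> P (a *: x + y) -> P (b *: x + y).
Proof.
move=> Px ab Pa.
have -> : b *: x + y = (b - a) *: x + (a *: x + y) by lin3_congr x y y; ring.
by apply: (cone_add HV) => //; apply: (cone_scale HV); rewrite ?subr_ge0.
Qed.

Lemma cone_symZ (k : R) (x v : V) : P (x + v) -> P (x - v) ->
  P (`|k| *: x + k *: v) /\ P (`|k| *: x - k *: v).
Proof.
move=> Pp Pm; have [k0|k0] := leP 0 k.
  by rewrite ger0_norm // -scalerDr -scalerBr; split; apply: (cone_scale HV).
have k0' : 0 <= - k by rewrite oppr_ge0 ltW.
rewrite ltr0_norm //; split.
- by rewrite -{2}[k]opprK [- - k *: v]scaleNr -scalerBr; apply: (cone_scale HV).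
- by rewrite -scaleNr -scalerDr; apply: (cone_scale HV).
Qed.

Lemma unit_norm_ge0 (v : V) : 0 <= norm v.
Proof.
apply: lb_le_inf; last by move=> k [/ltW].
by have [k Hk] := unit_order HV v; exists k.
Qed.

Lemma unit_norm_leP (v : V) (c : R) : 0 <= c ->
  norm v <= c <-> P (c *: e + v) /\ P (c *: e - v).
Proof.
set S := [set k : R | [/\ 0 < k, P (k *: e + v) & P (k *: e - v)]].
have lbS : has_lbound S by exists 0 => k [/ltW].
have iS : has_inf S by split=> //; have [k Hk] := unit_order HV v; exists k.
move=> c0; split=> [vc | [Pp Pm]]; last first.
  (* [c] itself may be 0, hence not in the set of which the norm is the
     infimum. *)
  apply/ler_addgt0Pr => eps eps0; apply: ge_inf => //.
  split; first by rewrite ltr_wpDl.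
  - by apply: cone_scale_mono Pp; [exact: (unit_pos HV) | rewrite lerDl ltW].
  - by apply: cone_scale_mono Pm; [exact: (unit_pos HV) | rewrite lerDl ltW].
have close (eps : R) : 0 < eps ->
    P ((eps + c) *: e + v) /\ P ((eps + c) *: e - v).
  move=> eps0; have [k [_ Pp Pm] kS] := inf_adherent eps0 iS.
  have kc : k <= eps + c by rewrite addrC; apply: (le_trans (ltW kS)); rewrite lerD2r.
  by split; [apply: cone_scale_mono Pp | apply: cone_scale_mono Pm] => //;
    exact: (unit_pos HV).
split; apply: (cone_archimedean HV (unit_pos HV)) => k k0;
  by rewrite addrA -scalerDl; have [] := close k k0.
Qed.

Lemma unit_norm_bounds (v : V) : P (norm v *: e + v) /\ P (norm v *: e - v).
Proof. by apply/(unit_norm_leP _ (unit_norm_ge0 v)). Qed.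

Lemma unit_normN (v : V) : norm (- v) = norm v.
Proof.
suff le_normN w : norm (- w) <= norm w.
  by apply/le_anti; rewrite le_normN -{1}[v]opprK le_normN.
apply/(unit_norm_leP _ (unit_norm_ge0 w)); rewrite opprK.
by have [? ?] := unit_norm_bounds w.
Qed.

Lemma unit_norm_eq0 (v : V) : norm v = 0 -> v = 0.
Proof.
move=> n0; have [] := unit_norm_bounds v; rewrite n0 scale0r add0r sub0r.
exact: (cone_proper HV).
Qed.

Lemma unit_norm_interval_le1 (v : V) : P v -> P (e - v) -> norm v <= 1.
Proof.
move=> Pv Pev; apply/(unit_norm_leP _ ler01); rewrite scale1r; split=> //.
by apply: (cone_add HV) => //; exact: (unit_pos HV).
Qed.

(** * Norm estimates for a complementary pair [u], [e - u] *)

Section Complement.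
Variable u : V.
Hypotheses (Pu : P u) (Peu : P (e - u)).

Lemma norm_compl_add_le (w : V) (n : R) : 0 <= n ->
  P (n *: u + w) -> P (n *: u - w) -> norm (e - u + w) <= Num.max 1 n.
Proof.
move=> n0 Pp Pm; set m := Num.max 1 n.
have m1 : 1 <= m by rewrite le_max lexx.
have mn : n <= m by rewrite le_max lexx orbT.
have m0 : 0 <= m by apply: le_trans m1.
apply/(unit_norm_leP _ m0); split.
- have -> : m *: e + (e - u + w) =
      (m + 1) *: (e - u) + (m - n) *: u + (n *: u + w).
    by lin3_congr e u w; ring.
  apply: (cone_add HV) => //; apply: (cone_add HV); apply: (cone_scale HV) => //.
  + by rewrite addr_ge0.
  + by rewrite subr_ge0.
- have -> : m *: e - (e - u + w) =
      (m - 1) *: (e - u) + (m - n) *: u + (n *: u - w).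
    by lin3_congr e u w; ring.
  by apply: (cone_add HV) => //; apply: (cone_add HV); apply: (cone_scale HV);
    rewrite ?subr_ge0.
Qed.

(** Adding [e - u <= s e - w <= s e + n u] to [n (e - u) = n e - n u] eliminates
    [u] and bounds [e - u] by [(s + n) / (1 + n)]; this is less than 1 if
    [s < 1]. *)
Lemma norm_compl_ge1 (w : V) (n : R) : 0 <= n -> norm (e - u) = 1 ->
  P (n *: u + w) -> 1 <= norm (e - u + w).
Proof.
move=> n0 neu Pp; rewrite leNgt; apply/negP.
have [_] := unit_norm_bounds (e - u + w).
have := unit_norm_ge0 (e - u + w); set s := norm _ => s0 Ps s1.
have n1 : 0 < 1 + n by lra.
have c0 : 0 <= (s + n) / (1 + n) by rewrite divr_ge0 ?addr_ge0.
have c1 : (s + n) / (1 + n) < 1 by rewrite ltr_pdivrMr // mul1r ltrD2r.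
suff : norm (e - u) <= (s + n) / (1 + n) by rewrite neu leNgt c1.
apply/(unit_norm_leP _ c0); split.
  by apply: (cone_add HV) => //; apply: (cone_scale HV) => //; exact: (unit_pos HV).
apply: (cone_scale_inv n1).
have -> : (1 + n) *: ((s + n) / (1 + n) *: e - (e - u)) =
    (s *: e - (e - u + w)) + (n *: u + w).
  by lin3_congr e u w; field; lra.
exact: (cone_add HV).
Qed.

(** The upper bound [w <= s e] holds because [e - u] is positive.  For the lower
    bound, [u] is eliminated between [w >= - n u] and [w >= - s e - (e - u)]:
    adding [n] times the second to the first gives
    [w >= - c e] with [c = n (s + 1) / (n + 1)], and [s <= c < n] if [s < n]. *)
Lemma norm_le_compl_add (w : V) :
  P (norm w *: u + w) -> norm w <= norm (e - u + w).
Proof.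
have := unit_norm_ge0 w; set n := norm w => n0 Pp; rewrite leNgt; apply/negP.
have [] := unit_norm_bounds (e - u + w).
have := unit_norm_ge0 (e - u + w); set s := norm (e - u + w) => s0 Pps Pms sn.
have n1 : 0 < n + 1 by lra.
set c := n * (s + 1) / (n + 1).
have sc : s <= c by rewrite ler_pdivlMr //; nra.
have cn : c < n by rewrite ltr_pdivrMr //; nra.
suff : n <= c by rewrite leNgt cn.
apply/(unit_norm_leP _ (le_trans s0 sc)); split.
  apply: (cone_scale_inv n1).
  have -> : (n + 1) *: (c *: e + w) =
      (n *: u + w) + n *: (s *: e + (e - u + w)).
    by lin3_congr e u w; rewrite /c; field; lra.
  by apply: (cone_add HV) => //; apply: (cone_scale HV).
apply: cone_scale_mono sc _; first exact: (unit_pos HV).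
have -> : s *: e - w = (s *: e - (e - u + w)) + (e - u).
  by lin3_congr e u w; ring.
exact: (cone_add HV).
Qed.

End Complement.

(** * The order unit property *)

Lemma oup_norm_eq1 (u : V) : P u -> u <> 0 -> P (e - u) ->
  order_unit_property P e u -> norm u = 1.
Proof.
move=> Pu u0 Peu oup; apply/le_anti; rewrite unit_norm_interval_le1 //=.
have [|_ Pm] := oup u.
  exists 1; split=> //; rewrite scale1r ?subrr; first exact: (cone_add HV).
  by rewrite -(scale0r u); apply: (cone_scale HV).
rewrite leNgt; apply/negP => lt1; apply: u0; apply: (cone_proper HV) => //.
apply: (@cone_scale_inv (1 - norm u)); first by rewrite subr_gt0.
by rewrite scalerN -scaleNr opprB scalerBl scale1r.
Qed.

(** If [c = norm (e - u) < 1], then [(1 - c) e <= u]: every element, and [e] in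
    particular, is dominated by a multiple of [u], and the order unit property
    at [e] contradicts [u <> e]. *)
Lemma oup_norm_compl_eq1 (u : V) : P u -> u <> e -> P (e - u) ->
  order_unit_property P e u -> norm (e - u) = 1.
Proof.
move=> Pu ue Peu oup; apply/le_anti; rewrite unit_norm_interval_le1 //=; last first.
  by rewrite subKr.
rewrite leNgt; apply/negP => lt1; apply: ue.
have [_] := unit_norm_bounds (e - u); move: lt1; set c := norm (e - u) => lt1 Pc.
have c1 : 0 < 1 - c by rewrite subr_gt0.
have ne1 : norm e <= 1.
  by apply: unit_norm_interval_le1; rewrite ?subrr -?(scale0r e);
    [|apply: (cone_scale HV) => //]; exact: (unit_pos HV).
have [|_ Pm] := oup e.
  exists (1 - c)^-1; rewrite invr_gt0; split=> //.
    apply: (cone_add HV); last exact: (unit_pos HV).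
    by apply: (cone_scale HV) => //; rewrite invr_ge0 ltW.
  apply: (cone_scale_inv c1).
  have -> : (1 - c) *: ((1 - c)^-1 *: u - e) = c *: e - (e - u).
    by lin3_congr u e e; field; lra.
  exact: Pc.
rewrite -opprB in Peu.
apply/eqP; rewrite -subr_eq0; apply/eqP; apply: (cone_proper HV) => //.
by have := cone_scale_mono Pu ne1 Pm; rewrite scale1r.
Qed.

Lemma oup_orthogonal (u : V) : P u -> P (e - u) -> norm (e - u) = 1 ->
  order_unit_property P e u ->
  forall v : V, order_interval P u v -> infty_orthogonal norm (e - u) v.
Proof.
move=> Pu Peu neu oup v [vl vr] k; rewrite neu.
have [Pp Pm] : P (u + v) /\ P (u - v).
  by split=> //; rewrite addrC -[u]opprK.
have [Pkp Pkm] := cone_symZ k Pp Pm.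
have [|Pnp Pnm] := oup (k *: v).
  (* [`|k|] alone may be 0. *)
  have le1 : `|k| <= `|k| + 1 by rewrite lerDl.
  exists (`|k| + 1); split; first by rewrite ltr_wpDl.
  - exact: cone_scale_mono le1 Pkp.
  - exact: cone_scale_mono le1 Pkm.
have n0 := unit_norm_ge0 (k *: v).
apply/le_anti; rewrite norm_compl_add_le //= ge_max.
by rewrite (norm_compl_ge1 Peu n0) // norm_le_compl_add.
Qed.

(** The half [e - u + w / n <= e] of the norm bound, taken for [w] and for
    [- w], gives [- n u <= w <= n u]. *)
Lemma orthogonal_oup (u : V) : P u -> norm (e - u) = 1 ->
  (forall v : V, order_interval P u v -> infty_orthogonal norm (e - u) v) ->
  order_unit_property P e u.
Proof.
move=> Pu neu orth v [lambda [l0 Pp Pm]].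
suff upper w : P (lambda *: u + w) -> P (lambda *: u - w) ->
    P (norm w *: u - w).
  split; last exact: upper.
  by have := upper (- v); rewrite unit_normN opprK; apply.
move=> {v} {}Pp {}Pm.
have [n0|n_neq0] := eqVneq (norm w) 0.
  by rewrite n0 scale0r (unit_norm_eq0 n0) subrr -(scale0r u); apply: (cone_scale HV).
have n0 : 0 < norm w by rewrite lt_def n_neq0 unit_norm_ge0.
have ln0 := lt0r_neq0 l0.
have wu : order_interval P u (lambda^-1 *: w).
  by split; rewrite /cone_le; apply: (cone_scale_inv l0);
    rewrite ?opprK !(scalerDr, scalerN) scalerA mulfV // scale1r // addrC.
have := orth _ wu ((norm w)^-1 * lambda).
rewrite scalerA mulfK // neu.
have nVw : norm ((norm w)^-1 *: w) <= 1.
  have [Pnp Pnm] := unit_norm_bounds w.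
  have [] := cone_symZ (norm w)^-1 Pnp Pnm.
  rewrite ger0_norm ?invr_ge0 ?unit_norm_ge0 // scalerA mulVf // => ? ?.
  by apply/(unit_norm_leP _ ler01).
rewrite (max_idPl nVw) => n1.
have [_] := unit_norm_bounds (e - u + (norm w)^-1 *: w); rewrite n1 => Pe.
have -> : norm w *: u - w = norm w *: (1 *: e - (e - u + (norm w)^-1 *: w)).
  (* [norm w] mentions [e] and [w]: generalizing it keeps the rewriting of these
     two vectors out of the scalars. *)
  by move: (norm w) n_neq0 => n n_neq0; lin3_congr e u w; field.
by apply: (cone_scale HV) => //; exact: ltW.
Qed.

End OrderUnitSpace.

Unset Implicit Arguments.
Set Strict Implicit.

Theorem theorem1p3 (R : realType) (V : lmodType R) (P : set V) (e : V)
    (HV : order_unit_space P e) (u : V) (Pu : P u) (u_neq0 : u <> 0)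
    (u_neqe : u <> e) :
  (* [cone_le P u e] cannot be dropped: 2 *: e has the order unit property but
     norm 2.  In the converse direction it is part of what is concluded. *)
  cone_le P u e /\ order_unit_property P e u <->
  [/\ unit_norm P e u = 1,
      unit_norm P e (e - u) = 1 &
      forall v : V, order_interval P u v ->
        infty_orthogonal (unit_norm P e) (e - u) v].
Proof.
split=> [[Peu oup] | [nu neu orth]].
  have neu := oup_norm_compl_eq1 HV Pu u_neqe Peu oup.
  by split=> //; [exact: (oup_norm_eq1 HV) | exact: (oup_orthogonal HV)].
split; last exact: (orthogonal_oup HV).
by have [_] := unit_norm_bounds HV u; rewrite nu scale1r.
Qed.
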